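(* Let $\varepsilon_1,\varepsilon_2$ be positive real numbers and let $\mathcal{P}=[0,\varepsilon_1]\times[0,\varepsilon_2]$ be the algebra of lifetimes, ordered by $(a_1,a_2)\le(b_1,b_2)$ iff $b_1\le a_1$ and $a_2\le b_2$, which is a complete Heyting algebra. The category of sheaves $[\mathcal{P}^{op},\mathrm{Set}]$ of sets over $\mathcal{P}$ is a topos, with subobject classifier $\Omega$ determined by the set of all sieves on $x$, that is, $$\Omega(x)=\downarrow x\quad\text{for all }x\in\mathcal{P},$$ with restriction maps $\downarrow x\to\downarrow y$ given by $z\mapsto z\wedge y$, for all $x,y\in\mathcal{P}$ such that $y\le x$.
   Context: For $x\in\mathcal{P}$, $\downarrow x=\{z\in\mathcal{P}\mid z\le x\}$. The lattice operations of $\mathcal{P}$ are $a\wedge b=(\max(a_1,b_1),\min(a_2,b_2))$ and $a\vee b=(\min(a_1,b_1),\max(a_2,b_2))$, with arbitrary meets and joins computed analogously coordinatewise. $\mathcal{P}$ is viewed as a poset category (one morphism $y\to x$ iff $y\le x$). A sieve on $x$ is a set of arrows into $x$ closed under precomposition with arrows of the category. A functor $F:\mathcal{P}^{op}\to\mathrm{Set}$ is a sheaf if, for every $x\in\mathcal{P}$, every family $(x_i)_{i\in I}$ in $\mathcal{P}$ with $x=\bigvee_{i\in I}x_i$, and every family $\{s_i\in F(x_i)\}_{i\in I}$ such that $s_i$ and $s_j$ have the same restriction to $F(x_i\wedge x_j)$ for all $i,j\in I$, there exists a unique $s\in F(x)$ whose restriction to $F(x_i)$ is $s_i$ for each $i\in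 I$. Here $[\mathcal{P}^{op},\mathrm{Set}]$ denotes the category of sheaves over $\mathcal{P}$: its objects are the sheaves $F:\mathcal{P}^{op}\to\mathrm{Set}$ and its morphisms are the natural transformations between them. A topos is a Cartesian closed category with all finite limits and a subobject classifier. A category is Cartesian closed if it has a terminal object and, for each pair of objects $X,Y$, the product $X\times Y$ and the exponential object $Y^X$ exist. A subobject classifier in a category with terminal object $*$ is an object $\Omega$ together with a monomorphism $\mathrm{true}:*\to\Omega$ such that for every monomorphism $U\to X$ there is a unique morphism $\chi_U:X\to\Omega$ for which $U\to X$ is the pullback of $\mathrm{true}$ along $\chi_U$. *)

(* Defs.v *)
From HB Require Import structures.
From mathcomp Require Import all_boot all_order all_algebra.
From mathcomp Require Import boolp classical_sets reals.

Set Implicit Arguments.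
Unset Strict Implicit.
Unset Printing Implicit Defensive.

Import Order.TTheory.
Local Open Scope classical_set_scope.
Local Open Scope order_scope.

Record category := Category {
  obj :> Type;
  Mor : obj -> obj -> Type;
  idm : forall x, Mor x x;
  compose : forall x y z, Mor y z -> Mor x y -> Mor x z;
  comp1m : forall x y (f : Mor x y), compose (idm y) f = f;
  compm1 : forall x y (f : Mor x y), compose f (idm x) = f;
  compA : forall x y z w (f : Mor z w) (g : Mor y z) (h : Mor x y),
    compose f (compose g h) = compose (compose f g) h }.

Arguments idm {c} x.
Declare Scope category_scope.
Delimit Scope category_scope with cat.
Notation "f ∘ g" := (compose f g) (at level 40, left associativity)
  : category_scope.
Local Open Scope category_scope.

Definition opcat (C : category) : category :=
  @Category C (fun x y => Mor y x) (fun x => idm x) (fun x y z f g => g ∘ f)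
    (fun x y f => compm1 f) (fun x y f => comp1m f)
    (fun x y z w f g h => esym (compA h g f)).

Record functor (C D : category) := Functor {
  fobj :> C -> D;
  fmap : forall x y, Mor x y -> Mor (fobj x) (fobj y);
  fmap1 : forall x, fmap (idm x) = idm (fobj x);
  fmapM : forall x y z (f : Mor y z) (g : Mor x y),
    fmap (f ∘ g) = fmap f ∘ fmap g }.

Record nat_trans (C D : category) (F G : functor C D) := NatTrans {
  component :> forall x, Mor (F x) (G x);
  naturality : forall x y (f : Mor x y),
    component y ∘ fmap F f = fmap G f ∘ component x }.

Lemma nat_trans_ext (C D : category) (F G : functor C D)
  (a b : nat_trans F G) : (forall x, a x = b x) -> a = b.
Proof.
case: a b => [a na] [b nb] /= ab.
have {}ab : a = b by apply: functional_extensionality_dep.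
by subst b; rewrite (Prop_irrelevance na nb).
Qed.

Definition nat_id (C D : category) (F : functor C D) : nat_trans F F.
Proof.
by exists (fun x => idm (F x)) => x y f; rewrite comp1m compm1.
Defined.

Definition nat_comp (C D : category) (F G H : functor C D)
  (a : nat_trans G H) (b : nat_trans F G) : nat_trans F H.
Proof.
exists (fun x => a x ∘ b x) => x y f.
by rewrite -compA naturality compA naturality compA.
Defined.

(* The category of sets at a fixed universe level. *)
Definition Sets : category :=
  @Category Type (fun X Y => X -> Y) (fun X x => x) (fun X Y Z g f x => g (f x))
    (fun X Y f => erefl) (fun X Y f => erefl) (fun X Y Z W f g h => erefl).

Section Universal.
Variable C : category.

Definition is_terminal (T : C) := forall X : C, exists! f : Mor X T, True.

Definition is_product (X Y P : C) (p1 : Mor P X) (p2 : Mor P Y) :=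
  forall (Z : C) (f : Mor Z X) (g : Mor Z Y),
  exists! h : Mor Z P, p1 ∘ h = f /\ p2 ∘ h = g.

(* [E] is the exponential object Y^X: [EX] is a product of [E] and [X], and for
   every product [ZX] of [Z] and [X], each [g : ZX -> Y] is [ev ∘ (h x id_X)]
   for a unique [h : Z -> E]; the arrow [h x id_X] is the [k] below. *)
Definition is_exponential (X Y E EX : C)
    (p1 : Mor EX E) (p2 : Mor EX X) (ev : Mor EX Y) :=
  is_product p1 p2 /\
  forall (Z ZX : C) (q1 : Mor ZX Z) (q2 : Mor ZX X), is_product q1 q2 ->
  forall g : Mor ZX Y, exists! h : Mor Z E,
    exists k : Mor ZX EX, [/\ p1 ∘ k = h ∘ q1, p2 ∘ k = q2 & ev ∘ k = g].

Definition cartesian_closed :=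
  [/\ exists T : C, is_terminal T,
      forall X Y : C, exists (P : C) (p1 : Mor P X) (p2 : Mor P Y),
        is_product p1 p2
    & forall X Y : C, exists (E EX : C)
        (p1 : Mor EX E) (p2 : Mor EX X) (ev : Mor EX Y),
        is_exponential p1 p2 ev].

Definition is_cone (J : category) (D : functor J C) (L : C)
    (c : forall j, Mor L (D j)) :=
  forall i j (f : Mor i j), fmap D f ∘ c i = c j.

Definition is_limit (J : category) (D : functor J C) (L : C)
    (c : forall j, Mor L (D j)) :=
  is_cone c /\
  forall (X : C) (x : forall j, Mor X (D j)), is_cone x ->
  exists! h : Mor X L, forall j, c j ∘ h = x j.

Definition is_mono (X Y : C) (m : Mor X Y) :=
  forall (Z : C) (f g : Mor Z X), m ∘ f = m ∘ g -> f = g.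

Definition is_pullback (P X Y Z : C) (p : Mor P X) (q : Mor P Y)
    (f : Mor X Z) (g : Mor Y Z) :=
  f ∘ p = g ∘ q /\
  forall (W : C) (a : Mor W X) (b : Mor W Y), f ∘ a = g ∘ b ->
  exists! h : Mor W P, p ∘ h = a /\ q ∘ h = b.

Definition is_subobject_classifier (Omega : C) :=
  exists (T : C) (true : Mor T Omega), [/\ is_terminal T, is_mono true
  & forall (U X : C) (m : Mor U X), is_mono m ->
    exists! chi : Mor X Omega, exists u : Mor U T, is_pullback m u chi true].

End Universal.

(* Finite categories get their own record, rather than a finiteness predicate
   on [category], so that the universe level of their objects is not tied to
   that of the large category in which the limits are taken. *)
Record fin_category := FinCategory {
  fin_obj : finType;
  fin_hom : fin_obj -> fin_obj -> finType;
  fin_idm : forall x, fin_hom x x;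
  fin_comp : forall x y z, fin_hom y z -> fin_hom x y -> fin_hom x z;
  fin_comp1m : forall x y (f : fin_hom x y), fin_comp (fin_idm y) f = f;
  fin_compm1 : forall x y (f : fin_hom x y), fin_comp f (fin_idm x) = f;
  fin_compA : forall x y z w
      (f : fin_hom z w) (g : fin_hom y z) (h : fin_hom x y),
    fin_comp f (fin_comp g h) = fin_comp (fin_comp f g) h }.

Coercion category_of_fin (J : fin_category) : category :=
  @Category (fin_obj J) (fun x y => fin_hom x y) (@fin_idm J) (@fin_comp J)
    (@fin_comp1m J) (@fin_compm1 J) (@fin_compA J).

Definition has_finite_limits (C : category) :=
  forall (J : fin_category) (D : functor J C),
  exists (L : C) (c : forall j, Mor L (D j)), is_limit c.

Definition is_topos (C : category) :=
  [/\ cartesian_closed C, has_finite_limits C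
    & exists Omega : C, is_subobject_classifier Omega].

Record sieve (C : category) (x : C) := Sieve {
  sieve_mem :> forall y, Mor y x -> Prop;
  sieve_closed : forall y z (f : Mor y x) (g : Mor z y),
    sieve_mem f -> sieve_mem (f ∘ g) }.

Definition sieve_pullback (C : category) (x y : C) (f : Mor y x)
  (S : sieve x) : sieve y.
Proof.
exists (fun z g => S z (f ∘ g)) => z w g h Sg.
by rewrite compA; apply: sieve_closed.
Defined.

Definition complete_heyting (d : Order.disp_t) (L : latticeType d) :=
  [/\ forall A : set L, exists x, supremums A x,
      forall A : set L, exists x, infimums A x
    & forall a b : L, exists c : L, forall z, (z `&` a <= b) = (z <= c)].

Section Sheaves.
Variables (d : Order.disp_t) (L : latticeType d).

Definition poset_cat : category :=
  @Category L (fun y x => y <= x) (fun x => lexx x)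
    (fun x y z yz xy => le_trans xy yz)
    (fun _ _ _ => bool_irrelevance _ _) (fun _ _ _ => bool_irrelevance _ _)
    (fun _ _ _ _ _ _ _ => bool_irrelevance _ _).

Notation presheaf := (functor (opcat poset_cat) Sets).

Definition restr (F : presheaf) (x y : L) (yx : y <= x) : F x -> F y :=
  @fmap _ _ F x y yx.
Arguments restr F {x y} yx.

(* The index type [I] may be empty, so that sheaves are trivial at the least
   element. *)
Definition is_sheaf (F : presheaf) :=
  forall (x : L) (I : Type) (xs : I -> L), supremums (range xs) x ->
  forall s : forall i, F (xs i),
    (forall i j, restr F (leIl (xs i) (xs j)) (s i)
               = restr F (leIr (xs j) (xs i)) (s j)) ->
  exists! t : F x, forall i (xix : xs i <= x), restr F xix t = s i.

Record sheaf := Sheaf {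
  presheaf_of :> presheaf;
  sheafP : is_sheaf presheaf_of }.

Definition sheaf_cat : category.
Proof.
refine (@Category sheaf (fun F G => nat_trans F G) (fun F => nat_id F)
  (fun F G H a b => nat_comp a b) _ _ _).
- by move=> F G a; apply: nat_trans_ext => x; apply: comp1m.
- by move=> F G a; apply: nat_trans_ext => x; apply: compm1.
- by move=> F G H K a b c; apply: nat_trans_ext => x; apply: compA.
Defined.

Definition downset (x : L) : Type := {z : L | z <= x}.

Definition downset_restr (x y : L) (yx : y <= x) (z : downset x) :
  downset y := exist _ (val z `&` y) (leIr y (val z)).

Definition omega : presheaf.
Proof.
exists (downset : opcat poset_cat -> Sets) (fun x y yx => downset_restr yx).
- by move=> x; apply: funext => -[z zx]; apply: val_inj; apply/meet_idPl.
- move=> x y z zy yx; apply: funext => w; apply: val_inj => /=.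
  by rewrite -meetA; congr (_ `&` _); apply/esym/meet_idPr.
Defined.

Definition sieve_join (x : poset_cat) (S : sieve x) : set L :=
  supremums [set y : L | exists f : @Mor poset_cat y x, S y f].

(* As a presheaf, [omega] is the image of the presheaf of all sieves under the
   natural map that sends a sieve to the join of the domains of its arrows:
   sieves with the same join are identified, since a general sieve is not
   principal. *)
Definition omega_determined_by_sieves :=
  [/\ forall (x : poset_cat) (S : sieve x),
        exists z : downset x, sieve_join S (val z),
      forall (x : poset_cat) (z : downset x),
        exists S : sieve x, sieve_join S (val z)
    & forall (x y : poset_cat) (yx : Mor y x) (S : sieve x) (z : downset x),
        sieve_join S (val z) ->
        sieve_join (sieve_pullback yx S) (val (downset_restr yx z))].

End Sheaves.

Arguments restr {d L} F {x y} yx.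
Arguments omega {d} L.

Fact lifetime_display : Order.disp_t. Proof. exact: Order.Disp tt tt. Qed.

Section Lifetimes.
Variables (R : realType) (e1 e2 : R).

Record lifetime := Lifetime {
  coords :> R * R;
  _ : (coords.1 \in `[0%R, e1]) && (coords.2 \in `[0%R, e2]) }.

HB.instance Definition _ := [isSub for coords].
HB.instance Definition _ := [Choice of lifetime by <:].

Definition lifetime_le (a b : lifetime) : bool :=
  (b.1 <= a.1) && (a.2 <= b.2).

Fact lifetime_le_refl : reflexive lifetime_le.
Proof. by move=> a; rewrite /lifetime_le !lexx. Qed.

Fact lifetime_le_anti : antisymmetric lifetime_le.
Proof.
move=> a b; rewrite /lifetime_le => /andP[/andP[ba ab] /andP[ab' ba']].
apply: val_inj; rewrite /= [val a]surjective_pairing [val b]surjective_pairing.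
by congr (_, _); apply: le_anti; apply/andP.
Qed.

Fact lifetime_le_trans : transitive lifetime_le.
Proof.
move=> b a c /andP[ba ab] /andP[cb bc]; apply/andP; split.
  exact: le_trans cb ba.
exact: le_trans ab bc.
Qed.

HB.instance Definition _ := Order.Le_isPOrder.Build lifetime_display
  lifetime lifetime_le_refl lifetime_le_anti lifetime_le_trans.

Fact lifetime_meet_subproof (a b : lifetime) :
  (Order.max a.1 b.1 \in `[0%R, e1]) && (Order.min a.2 b.2 \in `[0%R, e2]).
Proof.
case: a b => [a /andP[a1 a2]] [b /andP[b1 b2]] /=.
by rewrite maxEle minEle; case: ifP => _; case: ifP => _; apply/andP; split.
Qed.

Fact lifetime_join_subproof (a b : lifetime) :
  (Order.min a.1 b.1 \in `[0%R, e1]) && (Order.max a.2 b.2 \in `[0%R, e2]).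
Proof.
case: a b => [a /andP[a1 a2]] [b /andP[b1 b2]] /=.
by rewrite maxEle minEle; case: ifP => _; case: ifP => _; apply/andP; split.
Qed.

Definition lifetime_meet (a b : lifetime) : lifetime :=
  @Lifetime (Order.max a.1 b.1, Order.min a.2 b.2) (lifetime_meet_subproof a b).

Definition lifetime_join (a b : lifetime) : lifetime :=
  @Lifetime (Order.min a.1 b.1, Order.max a.2 b.2) (lifetime_join_subproof a b).

Fact lifetime_meetP (x a b : lifetime) :
  (x <= lifetime_meet a b) = (x <= a) && (x <= b).
Proof.
by rewrite /Order.le /= /lifetime_le /= ge_max le_min andbACA.
Qed.

Fact lifetime_joinP (a b x : lifetime) :
  (lifetime_join a b <= x) = (a <= x) && (b <= x).
Proof.
by rewrite /Order.le /= /lifetime_le /= ge_max le_min andbACA.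
Qed.

HB.instance Definition _ := Order.POrder_MeetJoin_isLattice.Build
  lifetime_display lifetime lifetime_meetP lifetime_joinP.

End Lifetimes.

(* Main.v *)
Require Import Defs.
From mathcomp Require Import all_boot all_order all_algebra.
From mathcomp Require Import boolp classical_sets reals.

Set Implicit Arguments.
Unset Strict Implicit.
Unset Printing Implicit Defensive.

Import Order.TTheory.
Local Open Scope classical_set_scope.
Local Open Scope order_scope.
Local Open Scope category_scope.

(** Once lifetimes are known to form a complete Heyting algebra, nothing specific
    to them is used: the sheaves over any complete Heyting algebra [L] form a
    topos. The Heyting implication enters only through the distributivity of
    binary meets over arbitrary joins, in the form of [sup_below]: if [A] covers
    [x] and [y <= x], then the elements below [y] and below some member of [A]
    cover [y].

    Limits of sheaves are computed pointwise, and the exponential [G^F] has as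
    sections over [x] the natural families of maps [F y -> G y], for [y <= x].
    A family given on the members of a cover of [x] extends to every [y <= x]
    by gluing in [G] along the cover that [sup_below] induces on [y]
    ([exp_is_sheaf]).

    For [Omega x] the set of the elements below [x], gluing is the formation of
    joins ([omega_is_sheaf]), and [truth] selects the largest element over each
    [x]. Monomorphisms of sheaves are injective on sections, because sections
    over [x] are morphisms from the sheaf represented by [x]
    ([mono_injective]). The key point is [char_exists]: for a monomorphism
    [m : U -> X] and a section [s] of [X] over [x], the restrictions of [s]
    that lie in the image of [m] come from sections of [U] which glue, by
    injectivity. Hence among the [y <= x] over which [s] lies in the image there
    is a largest one, and this is the value at [s] of the characteristic
    morphism. So [z <= chi s] holds exactly when [s] restricted to [z] lies in
    the image, and naturality, the pullback property and uniqueness all follow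
    from this equivalence.

    The algebra of lifetimes is complete because bounded sets of reals have
    suprema, and its implication is computed coordinatewise, as in chains. *)

(** * Exponentials in a category *)

(** The definition of an exponential quantifies over all products of [Z] with
    [X]; as products are unique up to isomorphism, it is enough to curry from
    one chosen product for each [Z]. *)
Lemma exponential_of_chosen_products (C : category) (X Y E : C) (P : C -> C)
    (p1 : forall Z, Mor (P Z) Z) (p2 : forall Z, Mor (P Z) X)
    (ev : Mor (P E) Y) :
  (forall Z, is_product (p1 Z) (p2 Z)) ->
  (forall Z (g : Mor (P Z) Y), exists! h : Mor Z E,
     exists k : Mor (P Z) (P E),
       [/\ p1 E ∘ k = h ∘ p1 Z, p2 E ∘ k = p2 Z & ev ∘ k = g]) ->
  is_exponential (p1 E) (p2 E) ev.
Proof.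
move=> prodP curry; split=> // Z ZX q1 q2 prodZX g.
have [u [[u1 u2] _]] := prodP Z ZX q1 q2.
have [v [[v1 v2] _]] := prodZX (P Z) (p1 Z) (p2 Z).
have vu : v ∘ u = idm ZX.
  have [w [_ w_uniq]] := prodZX ZX q1 q2.
  rewrite -(w_uniq (v ∘ u)); last by rewrite !Defs.compA v1 v2.
  by apply: w_uniq; rewrite !compm1.
have uv : u ∘ v = idm (P Z).
  have [w [_ w_uniq]] := prodP Z (P Z) (p1 Z) (p2 Z).
  rewrite -(w_uniq (u ∘ v)); last by rewrite !Defs.compA u1 u2.
  by apply: w_uniq; rewrite !compm1.
have [h [[k [k1 k2 kev]] h_uniq]] := curry Z (g ∘ v).
exists h; split=> [|h' [k' [k'1 k'2 k'ev]]].
  exists (k ∘ u); split; first by rewrite Defs.compA k1 -Defs.compA u1.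
    by rewrite Defs.compA k2.
  by rewrite Defs.compA kev -Defs.compA vu compm1.
apply: h_uniq; exists (k' ∘ v); split.
    by rewrite Defs.compA k'1 -Defs.compA v1.
  by rewrite Defs.compA k'2.
by rewrite Defs.compA k'ev.
Qed.

(** * Joins in a complete Heyting algebra *)

(** The infimum of a set is the supremum of its lower bounds. *)
Lemma infimums_exists (d : Order.disp_t) (T : porderType d) :
  (forall A : set T, exists x, supremums A x) ->
  forall A : set T, exists x, infimums A x.
Proof.
move=> supE A; have [x [ubx lubx]] := supE (lbound A).
by exists x; split=> // a Aa; apply: lubx => z; exact.
Qed.

Section Frames.
Variables (d : Order.disp_t) (L : latticeType d).
Hypothesis HL : complete_heyting L.

Lemma sup_exists (A : set L) : exists x, supremums A x.
Proof. by case: HL. Qed.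

Lemma sup_leP (A : set L) x z :
  supremums A x -> (x <= z <-> forall a, A a -> a <= z).
Proof.
case=> ubx lubx; split=> [xz a Aa|]; last exact: lubx.
by apply: le_trans xz; exact: ubx.
Qed.

(** This is where the Heyting structure is used: an upper bound [u] of the new
    family is above [a `&` y] for each [a] in [A], so [A] and hence [x] lie
    below the implication from [y] to [u], that is, [x `&` y <= u]. *)
Lemma sup_below (A : set L) x y : supremums A x -> y <= x ->
  supremums [set z | z <= y /\ exists2 a, A a & z <= a] y.
Proof.
move=> [_ lubx] yx; split=> [z [] //|u ubu].
have [_ _ /(_ y u)[c cP]] := HL.
have xc : x <= c.
  apply: lubx => a Aa; rewrite -cP; apply: ubu; split; first exact: leIr.
  by exists a => //; exact: leIl.
by rewrite -cP (meet_idPr yx) in xc.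
Qed.

(** * Sections of sheaves *)

Notation presheaf := (functor (opcat (poset_cat L)) Sets).

Lemma restr_id (F : presheaf) x (xx : x <= x) (s : F x) : restr F xx s = s.
Proof.
rewrite (bool_irrelevance xx (lexx x)).
exact: (congr1 (fun f => f s) (@fmap1 _ _ F x)).
Qed.

Lemma restr_comp (F : presheaf) x y z (zy : z <= y) (yx : y <= x)
    (zx : z <= x) (s : F x) :
  restr F zy (restr F yx s) = restr F zx s.
Proof.
rewrite (bool_irrelevance zx (le_trans zy yx)); apply/esym.
exact: (congr1 (fun f => f s) (@fmapM _ _ F x y z zy yx)).
Qed.

Lemma nat_restr (F G : presheaf) (a : nat_trans F G) x y (yx : y <= x)
    (s : F x) :
  a y (restr F yx s) = restr G yx (a x s).
Proof. exact: (congr1 (fun f => f s) (@naturality _ _ F G a x y yx)). Qed.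

(** The law [rM] ranges over all proofs [zx] of [z <= x], so that it can be
    proved by lemmas such as [restr_comp] that leave this proof free. *)
Definition mk_presheaf (F : L -> Type)
    (r : forall x y, y <= x -> F x -> F y)
    (r1 : forall x (xx : x <= x) s, r x x xx s = s)
    (rM : forall x y z (zy : z <= y) (yx : y <= x) (zx : z <= x) s,
       r x z zx s = r y z zy (r x y yx s)) : presheaf :=
  @Functor (opcat (poset_cat L)) Sets F r
    (fun x => funext (r1 x (lexx x)))
    (fun x y z (zy : z <= y) (yx : y <= x) =>
       funext (rM x y z zy yx (le_trans zy yx))).

Definition mk_nat (F G : presheaf) (a : forall x, F x -> G x)
    (aP : forall x y (yx : y <= x) s,
       a y (restr F yx s) = restr G yx (a x s)) : nat_trans F G :=
  @NatTrans (opcat (poset_cat L)) Sets F G a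
    (fun x y yx => funext (aP x y yx)).

Lemma sheaf_mor_eq (F G : sheaf L) (a b : @Mor (sheaf_cat L) F G) :
  (forall x s, component a x s = component b x s) -> a = b.
Proof. by move=> ab; apply: nat_trans_ext => x; apply: funext => s. Qed.

Lemma sheaf_mor_at (F G : sheaf L) (a b : @Mor (sheaf_cat L) F G) :
  a = b -> forall x s, component a x s = component b x s.
Proof. by move=> ->. Qed.

Definition separated (F : presheaf) :=
  forall (A : set L) x (t t' : F x), supremums A x ->
    (forall z, A z -> forall zx : z <= x, restr F zx t = restr F zx t') ->
    t = t'.

(** The sheaf condition splits into uniqueness, stated with a covering set in
    place of an indexed family, and existence, where the compatibility may be
    used on every common lower bound and not only on the meets. *)
Lemma sheafI (F : presheaf) : separated F ->
  (forall x (I : Type) (xs : I -> L), supremums (range xs) x ->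
   forall s : forall i, F (xs i),
     (forall i j w (wi : w <= xs i) (wj : w <= xs j),
        restr F wi (s i) = restr F wj (s j)) ->
   exists t : F x, forall i (ix : xs i <= x), restr F ix t = s i) ->
  is_sheaf F.
Proof.
move=> sepF glueF x I xs supx s compat.
have [i j w wi wj|t tP] := glueF x I xs supx s.
  have wij : w <= xs i `&` xs j by rewrite lexI wi.
  by rewrite -(restr_comp wij (leIl _ _)) compat (restr_comp _ _ wj).
exists t; split=> // t' t'P; apply: (sepF _ _ _ _ supx) => _ [i _ <-] zx.
by rewrite tP t'P.
Qed.

Lemma sheaf_separated (F : sheaf L) : separated F.
Proof.
move=> A x t t' supx tt'.
have ubA z : A z -> z <= x by case: supx => ubx _; exact: ubx.
have rangeA : range (sval : {z | A z} -> L) = A.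
  by apply/seteqP; split=> [_ [[z Az] _ <-] //|z Az]; exists (exist _ z Az).
have supr : supremums (range (sval : {z | A z} -> L)) x by rewrite rangeA.
pose s (i : {z | A z}) := restr F (ubA _ (svalP i)) t.
have [|t0 [_ t0_uniq]] := @sheafP _ _ F _ _ _ supr s.
  move=> i j; have wx : sval i `&` sval j <= x.
    by apply: le_trans (ubA _ (svalP i)); exact: leIl.
  by rewrite !(restr_comp _ _ wx).
rewrite -(t0_uniq t); last first.
  by move=> i ix; rewrite (bool_irrelevance ix (ubA _ (svalP i))).
apply: t0_uniq => i ix; rewrite -tt'; last exact: svalP.
by rewrite (bool_irrelevance ix (ubA _ (svalP i))).
Qed.

(** A matching family is given here as a relation [M] between elements of [L]
    and sections over them, so that [M z s] can simply say how [s] arises, without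
    a choice of one section for each [z]. *)
Lemma sheaf_glue (F : sheaf L) (x : L) (M : forall z : L, F z -> Prop) :
  (forall z s z' s', M z s -> M z' s' ->
     forall w (wz : w <= z) (wz' : w <= z'), restr F wz s = restr F wz' s') ->
  supremums [set z : L | exists s, M z s] x ->
  exists t : F x, forall z s (zx : z <= x), M z s -> restr F zx t = s.
Proof.
move=> compat; pose I := {z : L & {s : F z | M z s}}.
have -> : [set z : L | exists s, M z s] = range (fun i : I => tag i).
  apply/seteqP; split=> [z [s Ms]|_ [[z [s Ms]] _ <-]]; last by exists s.
  by exists (existT _ z (exist _ s Ms)).
move=> supx.
have [|t [tP _]] := @sheafP _ _ F _ _ _ supx (fun i : I => sval (tagged i)).
  by move=> i j; apply: compat; exact: svalP.
by exists t => z s zx Ms; exact: (tP (existT _ z (exist _ s Ms))).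
Qed.

(** * Representable sheaves, products and limits *)

(** The representable presheaf at [u] takes the proposition [y <= u], as a type
    with at most one element, for its set of sections over [y]. *)
Definition rep_presheaf (u : L) : presheaf.
Proof.
apply: (@mk_presheaf (fun y => y <= u) (fun x y yx xu => le_trans yx xu));
  by move=> *; exact: bool_irrelevance.
Defined.

Lemma rep_sheaf (u : L) : is_sheaf (rep_presheaf u).
Proof.
apply: sheafI => [A x t t' _ _|x I xs [_ lubx] s _].
  exact: bool_irrelevance.
have xu : x <= u by apply: lubx => _ [i _ <-]; exact: s.
by exists xu => i ix; exact: bool_irrelevance.
Qed.

Definition rep (u : L) : sheaf L := Sheaf (@rep_sheaf u).

Definition yoneda (F : sheaf L) (u : L) (s : F u) : nat_trans (rep u) F.
Proof.
apply: (@mk_nat (rep u) F (fun y yu => restr F yu s)) => x y yx xu.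
by rewrite (restr_comp _ _ (le_trans yx xu)).
Defined.

Definition unit_presheaf : presheaf.
Proof. by apply: (@mk_presheaf (fun=> unit) (fun x y yx s => s)). Defined.

Lemma unit_is_sheaf : is_sheaf unit_presheaf.
Proof.
apply: sheafI => [A x [] [] //|x I xs _ s _].
by exists tt => i ix; case: (s i).
Qed.

Definition unit_sheaf : sheaf L := Sheaf unit_is_sheaf.

Lemma to_unit_eq (F : sheaf L) (a b : @Mor (sheaf_cat L) F unit_sheaf) : a = b.
Proof.
by apply: sheaf_mor_eq => x s; case: (component a x s); case: (component b x s).
Qed.

Lemma unit_terminal : @is_terminal (sheaf_cat L) unit_sheaf.
Proof.
move=> X.
exists (@mk_nat X unit_presheaf (fun _ _ => tt) (fun _ _ _ _ => erefl)).
by split=> // f _; exact: to_unit_eq.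
Qed.

Definition prod_presheaf (F G : presheaf) : presheaf.
Proof.
apply: (@mk_presheaf (fun x => (F x * G x)%type)
  (fun x y yx s => (restr F yx s.1, restr G yx s.2))).
- by move=> x xx [a b]; rewrite !restr_id.
- by move=> x y z zy yx zx [a b] /=; rewrite !(restr_comp _ _ zx).
Defined.

Lemma prod_is_sheaf (F G : sheaf L) : is_sheaf (prod_presheaf F G).
Proof.
apply: sheafI => [A x [a b] [a' b'] supx ab|x I xs supx s compat].
  congr (_, _); apply: (sheaf_separated supx) => z Az zx.
    exact: (congr1 fst (ab z Az zx)).
  exact: (congr1 snd (ab z Az zx)).
have [|a [aP _]] := @sheafP _ _ F _ _ _ supx (fun i => (s i).1).
  by move=> i j; exact: (congr1 fst (compat i j _ _ _)).
have [|b [bP _]] := @sheafP _ _ G _ _ _ supx (fun i => (s i).2).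
  by move=> i j; exact: (congr1 snd (compat i j _ _ _)).
by exists (a, b) => i ix; rewrite [RHS]surjective_pairing -aP -bP.
Qed.

Definition prod_sheaf (F G : sheaf L) : sheaf L :=
  Sheaf (@prod_is_sheaf F G).

Definition proj1 (F G : sheaf L) : @Mor (sheaf_cat L) (prod_sheaf F G) F :=
  @mk_nat (prod_presheaf F G) F (fun x s => s.1) (fun _ _ _ _ => erefl).

Definition proj2 (F G : sheaf L) : @Mor (sheaf_cat L) (prod_sheaf F G) G :=
  @mk_nat (prod_presheaf F G) G (fun x s => s.2) (fun _ _ _ _ => erefl).

Definition pairing (H F G : sheaf L) (a : nat_trans H F) (b : nat_trans H G) :
  @Mor (sheaf_cat L) H (prod_sheaf F G).
Proof.
apply: (@mk_nat H (prod_presheaf F G) (fun x s => (a x s, b x s))).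
by move=> x y yx s; rewrite !nat_restr.
Defined.

Lemma prod_sheaf_product (F G : sheaf L) : is_product (proj1 F G) (proj2 F G).
Proof.
move=> H a b; exists (pairing a b); split; first by split; exact: sheaf_mor_eq.
move=> h [ha hb]; apply: sheaf_mor_eq => x s.
by rewrite [RHS]surjective_pairing -ha -hb.
Qed.

Section Limits.
Variables (J : fin_category) (D : functor J (sheaf_cat L)).

Definition diag i j (f : Mor i j) : nat_trans (D i : sheaf L) (D j : sheaf L) :=
  fmap D f.

(** The index type is [fin_obj J] and not [J] seen as a category, whose objects
    live in a universe too large for a set of sections. *)
Definition lim_section (x : L) : Type :=
  {c : forall j : fin_obj J, (D j : sheaf L) x |
    forall i j (f : Mor i j), diag f x (c i) = c j}.

Lemma lim_section_eq x (c c' : lim_section x) :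
  (forall j, sval c j = sval c' j) -> c = c'.
Proof.
case: c c' => [c cP] [c' c'P] /= cc'; apply: eq_exist.
exact: functional_extensionality_dep.
Qed.

Definition lim_restr x y (yx : y <= x) (c : lim_section x) : lim_section y.
Proof.
exists (fun j => restr (D j : sheaf L) yx (sval c j)) => i j f.
by rewrite nat_restr (svalP c).
Defined.

Definition lim_presheaf : presheaf.
Proof.
apply: (@mk_presheaf lim_section lim_restr).
- by move=> x xx c; apply: lim_section_eq => j; exact: restr_id.
- move=> x y z zy yx zx c; apply: lim_section_eq => j.
  by rewrite /= (restr_comp _ _ zx).
Defined.

Lemma lim_is_sheaf : is_sheaf lim_presheaf.
Proof.
apply: sheafI => [A x c c' supx cc'|x I xs supx s compat].
  apply: lim_section_eq => j; apply: (sheaf_separated supx) => z Az zx.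
  exact: (congr1 (fun c => sval c j) (cc' z Az zx)).
have glue j : exists t : (D j : sheaf L) x,
    forall i (ix : xs i <= x), restr (D j : sheaf L) ix t = sval (s i) j.
  have [|t [tP _]] := @sheafP _ _ (D j) _ _ _ supx (fun i => sval (s i) j);
    last by exists t.
  by move=> i i'; exact: (congr1 (fun c => sval c j) (compat i i' _ _ _)).
pose t j := sval (cid (glue j)).
have tP j i ix : restr _ ix (t j) = sval (s i) j := svalP (cid (glue j)) i ix.
have tD i j (f : Mor i j) : diag f x (t i) = t j.
  apply: (sheaf_separated supx) => _ [k _ <-] zx.
  by rewrite -nat_restr !tP (svalP (s k)).
by exists (exist _ t tD) => i ix; apply: lim_section_eq => j; exact: tP.
Qed.

Definition lim_sheaf : sheaf L := Sheaf lim_is_sheaf.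

Definition lim_proj (j : J) : @Mor (sheaf_cat L) lim_sheaf (D j) :=
  @mk_nat lim_presheaf (D j : sheaf L) (fun x c => sval c j)
    (fun _ _ _ _ => erefl).

Lemma lim_sheaf_limit : is_limit lim_proj.
Proof.
split=> [i j f|H a aP].
  by apply: sheaf_mor_eq => x c; exact: (svalP c i j f).
pose an j : nat_trans H (D j : sheaf L) := a j.
have anP x s i j (f : Mor i j) : diag f x (an i x s) = an j x s.
  exact: (sheaf_mor_at (aP i j f)).
pose h x (s : H x) : lim_section x := exist _ (fun j => an j x s) (anP x s).
have hP x y (yx : y <= x) s :
    h y (restr H yx s) = restr lim_presheaf yx (h x s).
  by apply: lim_section_eq => j /=; exact: nat_restr.
exists (@mk_nat H lim_presheaf h hP); split=> [j|h' h'P].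
  exact: sheaf_mor_eq.
apply: sheaf_mor_eq => x s; apply: lim_section_eq => j.
by apply/esym; exact: (sheaf_mor_at (h'P j)).
Qed.

End Limits.

(** * Exponentials of sheaves *)

Section Exponential.
Variables F G : sheaf L.

Definition exp_section (x : L) : Type :=
  {a : forall y, y <= x -> F y -> G y |
    forall y z (yx : y <= x) (zx : z <= x) (zy : z <= y) s,
      a z zx (restr F zy s) = restr G zy (a y yx s)}.

Lemma exp_section_eq x (a b : exp_section x) :
  (forall y yx s, sval a y yx s = sval b y yx s) -> a = b.
Proof.
case: a b => [a aP] [b bP] /= ab; apply: eq_exist.
apply: functional_extensionality_dep => y.
by apply: functional_extensionality_dep => yx; apply: funext => s.
Qed.

Lemma exp_section_restr x (a : exp_section x) y z (yx : y <= x) (zx : z <= x)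
    (zy : z <= y) s :
  sval a z zx (restr F zy s) = restr G zy (sval a y yx s).
Proof. exact: (proj2_sig a). Qed.

Definition exp_restr x y (yx : y <= x) (a : exp_section x) : exp_section y.
Proof.
exists (fun z zy => sval a z (le_trans zy yx)) => z w zy wy wz s.
exact: exp_section_restr.
Defined.

Lemma sval_exp_irr x (a : exp_section x) y (p q : y <= x) s :
  sval a y p s = sval a y q s.
Proof. by rewrite (bool_irrelevance p q). Qed.

Definition exp_presheaf : presheaf.
Proof.
apply: (@mk_presheaf exp_section exp_restr).
- by move=> x xx a; apply: exp_section_eq => y yx s /=; exact: sval_exp_irr.
- move=> x y z zy yx zx a; apply: exp_section_eq => w wz s /=.
  exact: sval_exp_irr.
Defined.

(** The value at [s : F y] of the glued family is itself obtained by gluing in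
    [G]: over [z] below both [y] and a member [xs i] of the cover, it must
    restrict to the value of the [i]-th family at the restriction of [s]. *)
Lemma exp_is_sheaf : is_sheaf exp_presheaf.
Proof.
apply: sheafI => [A x a b supx ab|x I xs supx a compat].
  apply: exp_section_eq => y yx s.
  apply: (sheaf_separated (sup_below supx yx)) => z [_ [u Au zu]] zy.
  have ux : u <= x by case: supx => ubx _; exact: ubx.
  have zx := le_trans zu ux.
  rewrite -!(exp_section_restr _ yx zx zy).
  have := congr1 (fun c => sval c z zu (restr F zy s)) (ab u Au ux) => /=.
  by rewrite !(sval_exp_irr _ _ zx).
have agree i j z (zi : z <= xs i) (zj : z <= xs j) s :
    sval (a i) z zi s = sval (a j) z zj s.
  have := congr1 (fun c => sval c z (lexx z) s) (compat i j z zi zj).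
  by rewrite /= (sval_exp_irr _ _ zi) (sval_exp_irr _ _ zj).
have glue y (yx : y <= x) (s : F y) : exists b : G y,
    forall i z (zi : z <= xs i) (zy : z <= y),
      restr G zy b = sval (a i) z zi (restr F zy s).
  pose M (z : L) (b : G z) := exists i (zi : z <= xs i) (zy : z <= y),
    b = sval (a i) z zi (restr F zy s).
  have [||b bP] := @sheaf_glue G y M.
  - move=> z b z' b' [i [zi [zy ->]]] [j [z'j [z'y ->]]] w wz wz'.
    have wi := le_trans wz zi; have wj := le_trans wz' z'j.
    have wy := le_trans wz zy.
    rewrite -(exp_section_restr _ zi wi) -(exp_section_restr _ z'j wj).
    by rewrite !(restr_comp _ _ wy); exact: agree.
  - have -> : [set z : L | exists b, M z b]
        = [set z | z <= y /\ exists2 u, range xs u & z <= u].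
      apply/seteqP; split=> [z [b [i [zi [zy _]]]]|z [zy [_ [i _ <-] zi]]].
        by split=> //; exists (xs i).
      by exists (sval (a i) z zi (restr F zy s)), i, zi, zy.
    exact: sup_below supx yx.
  - by exists b => i z zi zy; apply: bP; exists i, zi, zy.
pose b y yx s := sval (cid (glue y yx s)).
have bP y yx s i z (zi : z <= xs i) (zy : z <= y) :
    restr G zy (b y yx s) = sval (a i) z zi (restr F zy s).
  exact: svalP (cid (glue y yx s)) i z zi zy.
have bN y z (yx : y <= x) (zx : z <= x) (zy : z <= y) s :
    b z zx (restr F zy s) = restr G zy (b y yx s).
  apply: (sheaf_separated (sup_below supx zx)) => w [_ [_ [i _ <-] wi]] wz.
  have wy := le_trans wz zy.
  by rewrite (bP _ _ _ i _ wi) !(restr_comp _ _ wy) (bP _ _ _ i _ wi).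
exists (exist _ b bN) => i ix; apply: exp_section_eq => y yi s /=.
by rewrite -[LHS](restr_id (lexx y)) (bP _ _ _ i _ yi) restr_id.
Qed.

Definition exp_sheaf : sheaf L := Sheaf exp_is_sheaf.

Definition exp_eval : @Mor (sheaf_cat L) (prod_sheaf exp_sheaf F) G.
Proof.
apply: (@mk_nat (prod_presheaf exp_presheaf F) G
  (fun x s => sval s.1 x (lexx x) s.2)) => x y yx [a s].
rewrite -(exp_section_restr a (lexx x) yx yx) /=; exact: sval_exp_irr.
Defined.

Definition curry_section (H : sheaf L) (g : nat_trans (prod_sheaf H F) G)
  x (t : H x) : exp_section x.
Proof.
exists (fun y yx s => g y (restr H yx t, s)) => y z yx zx zy s.
by rewrite -nat_restr /= (restr_comp _ _ zx).
Defined.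

Definition curry (H : sheaf L) (g : nat_trans (prod_sheaf H F) G) :
  @Mor (sheaf_cat L) H exp_sheaf.
Proof.
apply: (@mk_nat H exp_presheaf (curry_section g)) => x y yx t.
apply: exp_section_eq => z zy s /=.
by rewrite (restr_comp _ _ (le_trans zy yx)).
Defined.

(** A morphism [h] into the exponential is recovered from its composite with the
    evaluation since, by naturality, the family [h t] takes at [s] over [y]
    the value that the restriction of [h t] to [y] takes at the top of its
    domain. *)
Lemma exp_sheaf_exponential :
  is_exponential (proj1 exp_sheaf F) (proj2 exp_sheaf F) exp_eval.
Proof.
apply: (exponential_of_chosen_products
  (P := fun H : sheaf_cat L => prod_sheaf H F)
  (p1 := fun H => proj1 H F) (p2 := fun H => proj2 H F)).
  by move=> H; exact: prod_sheaf_product.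
move=> H g; exists (curry g); split.
  exists (pairing (nat_comp (curry g) (proj1 H F)) (proj2 H F)).
  split; apply: sheaf_mor_eq => // x [t s].
  by rewrite /= restr_id.
move=> h [k [k1 k2 kev]]; apply: sheaf_mor_eq => x t.
apply: exp_section_eq => y yx s /=.
pose ts : prod_sheaf H F y := (restr H yx t, s).
rewrite -[LHS]/(component g y ts) -(sheaf_mor_at kev).
have k1ts := sheaf_mor_at k1 ts; have k2ts := sheaf_mor_at k2 ts.
rewrite /= in k1ts k2ts.
rewrite /= k1ts k2ts nat_restr /=; exact: sval_exp_irr.
Qed.

End Exponential.

(** * The subobject classifier *)

Lemma omega_restr_val x y (yx : y <= x) (c : omega L x) :
  val (restr (omega L) yx c : downset y) = val (c : downset x) `&` y.
Proof. by []. Qed.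

(** The sections over the members of a cover glue to their join. Its meet with
    [xs i] is no larger than the [i]-th section: below any other section,
    compatibility bounds the elements under [xs i] by the [i]-th section, and
    those elements cover the meet. *)
Lemma omega_is_sheaf : is_sheaf (omega L).
Proof.
apply: sheafI => [A x c c' supx cc'|x I xs supx c compat].
  have ubA a : A a -> a <= x by case: supx => ubx _; exact: ubx.
  have le_of (b b' : downset x) :
      (forall a, A a -> val b `&` a = val b' `&` a) -> val b <= val b'.
    move=> bb'; apply/(sup_leP _ (sup_below supx (valP b))).
    move=> z [zb [a Aa za]]; have : z <= val b `&` a by rewrite lexI zb.
    by rewrite (bb' a Aa) lexI => /andP[].
  have val_cc' a (Aa : A a) := congr1 val (cc' a Aa (ubA a Aa)).
  have ge_of := le_of c' c (fun a Aa => esym (val_cc' a Aa)).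
  by apply: val_inj; apply: le_anti; rewrite (le_of c c' val_cc') ge_of.
have agree i j w : w <= xs i -> w <= xs j ->
    val (c i : downset _) `&` w = val (c j : downset _) `&` w.
  by move=> wi wj; exact: (congr1 val (compat i j w wi wj)).
have [t supt] := sup_exists (range (fun i => val (c i : downset (xs i)))).
have ct i : val (c i : downset _) <= t.
  by case: supt => ubt _; apply: ubt; exists i.
have tx : t <= x.
  apply/(sup_leP _ supt) => _ [i _ <-].
  apply: le_trans (valP (c i : downset _)) _.
  by case: supx => ubx _; apply: ubx; exists i.
exists (exist _ t tx : downset x) => i ix; apply: val_inj.
rewrite omega_restr_val /=; apply: le_anti; apply/andP; split; last first.
  by rewrite lexI ct; exact: (valP (c i : downset _)).
apply/(sup_leP _ (sup_below supt (leIl t (xs i)))).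
move=> z [zti [_ [j _ <-] zcj]].
have zi : z <= xs i := le_trans zti (leIr _ _).
have zj : z <= xs j := le_trans zcj (valP (c j : downset _)).
have : z <= val (c j : downset _) `&` z by rewrite lexI zcj lexx.
by rewrite -(agree i) // lexI => /andP[].
Qed.

Definition omega_sheaf : sheaf L := Sheaf omega_is_sheaf.

Definition truth : @Mor (sheaf_cat L) unit_sheaf omega_sheaf.
Proof.
apply: (@mk_nat unit_presheaf (omega L)
  (fun x _ => exist _ x (lexx x) : downset x)) => x y yx s.
by apply: val_inj; rewrite omega_restr_val /=; apply/esym/meet_idPr.
Defined.

Lemma truth_mono : is_mono truth.
Proof.
by move=> H f g _; exact: to_unit_eq.
Qed.

Lemma downset_eq (x : L) (b c : downset x) :
  (forall z : L, z <= x -> (z <= val b <-> z <= val c)) -> b = c.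
Proof.
move=> bc; apply: val_inj; apply: le_anti; apply/andP; split.
  by apply/(bc _ (valP b)).
by apply/(bc _ (valP c)).
Qed.

(** By the Yoneda lemma, two sections over [x] with the same image are two
    morphisms from the sheaf represented by [x] that [m] equalizes. *)
Lemma mono_injective (U X : sheaf L) (m : @Mor (sheaf_cat L) U X) :
  is_mono m -> forall x, injective (component m x).
Proof.
move=> mono_m x s t mst.
have : yoneda s = yoneda t :> @Mor (sheaf_cat L) (rep x) U.
  apply: mono_m; apply: sheaf_mor_eq => y yx /=.
  by rewrite !nat_restr mst.
by move=> /sheaf_mor_at/(_ x (lexx x)) /=; rewrite !restr_id.
Qed.

Section Characteristic.
Variables (U X : sheaf L) (m : nat_trans U X).
Hypothesis m_inj : forall x, injective (m x).

Definition in_image x (s : X x) : Prop := exists u, m x u = s.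

Lemma in_image_restr x y (yx : y <= x) (s : X x) :
  in_image s -> in_image (restr X yx s).
Proof. by move=> [u <-]; exists (restr U yx u); rewrite nat_restr. Qed.

(** The largest [y] is the join [c] of all [y] over which [s] is in the image.
    That [s] is still in the image over [c] holds because [U] is a sheaf: by
    injectivity of [m] the preimages match, so they glue over [c], and the glued
    section is sent to the restriction of [s] because [X] is separated. *)
Lemma char_exists (x : L) (s : X x) : exists c : downset x,
  forall y (yx : y <= x), y <= val c <-> in_image (restr X yx s).
Proof.
pose A := [set y : L | exists yx : y <= x, in_image (restr X yx s)].
have [c supc] := sup_exists A.
have cx : c <= x by apply/(sup_leP _ supc) => y [].
have [||u uP] := @sheaf_glue U c
  (fun y u => exists yx : y <= x, m y u = restr X yx s).
- move=> y u y' u' [yx mu] [y'x mu'] w wy wy'; apply: m_inj.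
  have wx := le_trans wy yx.
  by rewrite !nat_restr mu mu' !(restr_comp _ _ wx).
- rewrite [X in supremums X](_ : _ = A) //.
  by apply/seteqP; split=> [y [u [yx mu]]|y [yx [u mu]]];
    [exists yx, u|exists u, yx].
have mu : m c u = restr X cx s.
  apply: (sheaf_separated supc) => y [yx [v mv]] yc.
  by rewrite -nat_restr (uP y v) ?(restr_comp _ _ yx) //; exists yx.
exists (exist _ c cx) => y yx; split=> [yc|im_y].
  by rewrite -(restr_comp yc cx) -mu; apply: in_image_restr; exists u.
by case: supc => ubc _; apply: ubc; exists yx.
Qed.

Definition char_at x (s : X x) : downset x := sval (cid (char_exists s)).

Lemma char_atP x (s : X x) y (yx : y <= x) :
  y <= val (char_at s) <-> in_image (restr X yx s).
Proof. exact: (svalP (cid (char_exists s)) y yx). Qed.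

Lemma char_at_restr x y (yx : y <= x) (s : X x) :
  char_at (restr X yx s) = restr (omega L) yx (char_at s).
Proof.
apply: downset_eq => z zy; have zx := le_trans zy yx.
rewrite omega_restr_val lexI zy andbT.
apply: iff_trans (char_atP _ zy) _; rewrite (restr_comp _ _ zx).
by apply: iff_sym; exact: char_atP.
Qed.

Definition char : @Mor (sheaf_cat L) X omega_sheaf :=
  @mk_nat X (omega L) char_at char_at_restr.

Lemma char_true x (s : X x) :
  char_at s = exist _ x (lexx x) <-> in_image s.
Proof.
split=> [cs|im_s].
  by rewrite -(restr_id (lexx x) s); apply/char_atP; rewrite cs.
apply: val_inj; apply: le_anti; rewrite (valP (char_at s)) /=.
by apply/char_atP; rewrite restr_id.
Qed.

Lemma char_pullback (u : @Mor (sheaf_cat L) U unit_sheaf) :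
  @is_pullback (sheaf_cat L) _ _ _ _ m u char truth.
Proof.
split=> [|W a b ab].
  by apply: sheaf_mor_eq => x s; apply/char_true; exists s.
pose an : nat_trans W X := a.
have im x (w : W x) : in_image (an x w).
  by apply/char_true; exact: (sheaf_mor_at ab).
pose h x (w : W x) : U x := sval (cid (im x w)).
have hP x (w : W x) : m x (h x w) = an x w := svalP (cid (im x w)).
have hN x y (yx : y <= x) w : h y (restr W yx w) = restr U yx (h x w).
  by apply: m_inj; rewrite hP !nat_restr hP.
exists (@mk_nat W U h hN); split=> [|h' [mh' _]].
  split; first by apply: sheaf_mor_eq => x w; exact: hP.
  exact: to_unit_eq.
apply: sheaf_mor_eq => x w; apply: m_inj.
by rewrite [LHS]hP -(sheaf_mor_at mh').
Qed.

(** Both values at [s] have the same lower bounds. If [z <= chi s], then [chi]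
    sends the restriction of [s] to [z] to the largest element over [z]; the
    pullback property, applied to this restriction seen as a morphism from the
    sheaf represented by [z], puts it in the image of [m]. *)
Lemma char_unique (chi : nat_trans X omega_sheaf)
    (u : @Mor (sheaf_cat L) U unit_sheaf) :
  @is_pullback (sheaf_cat L) _ _ _ _ m u chi truth ->
  char = chi :> @Mor (sheaf_cat L) X omega_sheaf.
Proof.
move=> [comm univ]; apply: sheaf_mor_eq => x s; apply: downset_eq => z zx.
apply: (iff_trans (char_atP s zx)); split=> [[v mv]|zchi].
  have := congr1 val (sheaf_mor_at comm v).
  rewrite /= mv nat_restr omega_restr_val /= => /meet_idPr; exact.
have [b _] := unit_terminal (rep z).
have [|h [[mh _] _]] := univ (rep z) (yoneda (restr X zx s)) b.
  apply: sheaf_mor_eq => y yz; apply: val_inj => /=.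
  rewrite !nat_restr !omega_restr_val /= -meetA (meet_idPr yz).
  by apply/meet_idPr; exact: le_trans zchi.
exists (component h z (lexx z)).
by rewrite -[RHS](restr_id (lexx z)); exact: (sheaf_mor_at mh).
Qed.

End Characteristic.

Lemma omega_subobject_classifier :
  @is_subobject_classifier (sheaf_cat L) omega_sheaf.
Proof.
exists unit_sheaf, truth; split; [exact: unit_terminal|exact: truth_mono|].
move=> U X m /mono_injective m_inj; have [u _] := unit_terminal U.
exists (char m_inj); split; first by exists u; exact: char_pullback.
by move=> chi [u' pb]; exact: char_unique pb.
Qed.

Lemma sheaf_topos : is_topos (sheaf_cat L).
Proof.
split; last by exists omega_sheaf; exact: omega_subobject_classifier.
  split; first by exists unit_sheaf; exact: unit_terminal.
    move=> F G; exists (prod_sheaf F G), (proj1 F G), (proj2 F G).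
    exact: prod_sheaf_product.
  move=> F G; exists (exp_sheaf F G), (prod_sheaf (exp_sheaf F G) F).
  exists (proj1 _ _), (proj2 _ _), (exp_eval F G).
  exact: exp_sheaf_exponential.
move=> J D; exists (lim_sheaf D), (lim_proj D); exact: lim_sheaf_limit.
Qed.

(** An element [z] below [x] is the join of the principal sieve of the arrows
    with domain below [z]; that the join of a sieve is stable under pullback is
    distributivity, by [sup_below]. *)
Lemma omega_of_sieves : omega_determined_by_sieves L.
Proof.
split=> [x S|x z|x y yx S z [ubz lubz]].
- have [z supz] := sup_exists
    [set y : L | exists f : @Mor (poset_cat L) y x, S y f].
  suff zx : z <= x by exists (exist _ z zx).
  by apply/(sup_leP _ supz) => y [].
- have S_closed (y w : poset_cat L) (f : Mor y x) (g : Mor w y) :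
      y <= val z -> w <= val z by exact: le_trans.
  exists (@Sieve (poset_cat L) x (fun y _ => y <= val z) S_closed).
  split=> [y [] //|u ubu]; apply: ubu => /=.
  by exists (valP z).
- split=> [w [wy Sw]|u ubu].
    rewrite /= lexI; apply/andP; split=> //.
    by apply: ubz; exists (yx ∘ wy).
  apply/(sup_leP _ (sup_below (conj ubz lubz) (leIl (val z) y))).
  move=> w [wzy [a [f Sf] wa]].
  have wy : w <= y := le_trans wzy (leIr _ _).
  apply: ubu; exists wy => /=.
  have := @sieve_closed (poset_cat L) x S a w f wa Sf.
  by rewrite (bool_irrelevance (@compose (poset_cat L) _ _ _ f wa) (yx ∘ wy)).
Qed.

End Frames.

(** * The algebra of lifetimes *)

(** Relative to the interval the empty set has a supremum, namely [0]; adding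
    [0] to [A] avoids treating this case apart. *)
Lemma interval_sup (R : realType) (e : R) (A : set R) : (0 <= e)%R ->
  A `<=` [set` `[0%R, e]] ->
  exists2 s, s \in `[0%R, e] &
    forall u, u \in `[0%R, e] -> (s <= u <-> forall a, A a -> a <= u).
Proof.
move=> e0 Ae; pose B := A `|` [set 0%R].
have Be b : B b -> 0%R <= b <= e.
  by move=> [/Ae /=|->]; rewrite ?in_itv //= lexx.
have B0 : B !=set0 by exists 0%R; right.
have supB : has_sup B by split=> //; exists e => b /Be /andP[].
exists (sup B).
  rewrite in_itv /=; apply/andP; split.
    by apply: sup_upper_bound => //; right.
  by apply: ge_sup => // b /Be /andP[].
move=> u; rewrite in_itv /= => /andP[u0 _]; split=> [su a Aa|Au].
  by apply: le_trans su; apply: sup_upper_bound => //; left.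
by apply: ge_sup => // b [/Au|->].
Qed.

Lemma interval_inf (R : realType) (e : R) (A : set R) : (0 <= e)%R ->
  A `<=` [set` `[0%R, e]] ->
  exists2 s, s \in `[0%R, e] &
    forall u, u \in `[0%R, e] -> (u <= s <-> forall a, A a -> u <= a).
Proof.
move=> e0 Ae.
pose B := [set b | b \in `[0%R, e] /\ forall a, A a -> b <= a].
have [|s se sP] := @interval_sup _ _ B e0; first by move=> b [].
exists s => // u ue; split=> [us a Aa|uA].
  by apply: le_trans us _; apply/(sP _ (Ae _ Aa)) => b [_]; exact.
by apply: (sP s se).1 => //; split.
Qed.

Section LifetimeHeyting.
Variables (R : realType) (e1 e2 : R).
Hypotheses (e1_ge0 : (0 <= e1)%R) (e2_ge0 : (0 <= e2)%R).
Notation P := (lifetime e1 e2).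

Lemma lifetime_leE (a b : P) : (a <= b) = (b.1 <= a.1) && (a.2 <= b.2).
Proof. by []. Qed.

Lemma lifetime_meetE (a b : P) :
  coords (a `&` b) = (Order.max a.1 b.1, Order.min a.2 b.2).
Proof. by []. Qed.

Lemma lifetime_mem1 (a : P) : a.1 \in `[0%R, e1].
Proof. by case: a => a /= /andP[]. Qed.

Lemma lifetime_mem2 (a : P) : a.2 \in `[0%R, e2].
Proof. by case: a => a /= /andP[]. Qed.

Lemma lifetime_sup_exists (A : set P) : exists x, supremums A x.
Proof.
have [|i ie iP] := @interval_inf _ _ [set a.1 | a in A] e1_ge0.
  by move=> _ [a _ <-]; exact: lifetime_mem1.
have [|s se sP] := @interval_sup _ _ [set a.2 | a in A] e2_ge0.
  by move=> _ [a _ <-]; exact: lifetime_mem2.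
have is_mem : ((i, s).1 \in `[0%R, e1]) && ((i, s).2 \in `[0%R, e2]).
  by apply/andP.
exists (Lifetime is_mem); split=> [a Aa|u ubu]; rewrite lifetime_leE /=.
  apply/andP; split; first by apply: (iP i ie).1 => //; exists a.
  by apply: (sP s se).1 => //; exists a.
apply/andP; split.
  by apply/(iP _ (lifetime_mem1 u)) => _ [a /ubu /andP[ua _] <-].
by apply/(sP _ (lifetime_mem2 u)) => _ [a /ubu /andP[_ au] <-].
Qed.

(** In each coordinate, implication is that of a chain: the top element when the
    inequality already holds and the right-hand side otherwise. The first
    coordinate is ordered in reverse, so its top is [0]. *)
Lemma lifetime_implication (a b : P) :
  exists c : P, forall z : P, (z `&` a <= b) = (z <= c).
Proof.
pose c := (if b.1 <= a.1 then 0%R else b.1, if a.2 <= b.2 then e2 else b.2).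
have c_mem : (c.1 \in `[0%R, e1]) && (c.2 \in `[0%R, e2]).
  rewrite /c /=; apply/andP; split; case: ifP => _;
    rewrite ?lifetime_mem1 ?lifetime_mem2 // in_itv /= lexx ?e1_ge0 ?e2_ge0 //.
exists (Lifetime c_mem) => z; rewrite !lifetime_leE lifetime_meetE /=.
have := lifetime_mem1 z; have := lifetime_mem2 z.
rewrite !in_itv /= => /andP[_ ze2] /andP[z0 _].
rewrite le_max ge_min; congr (_ && _); case: ifP => _.
- by rewrite orbT z0.
- by rewrite orbF.
- by rewrite orbT ze2.
- by rewrite orbF.
Qed.

Lemma lifetime_complete_heyting : complete_heyting P.
Proof.
split; first exact: lifetime_sup_exists.
  exact: infimums_exists lifetime_sup_exists.
exact: lifetime_implication.
Qed.

End LifetimeHeyting.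

Theorem proposition4p2 (R : realType) (e1 e2 : R)
    (e1_gt0 : (0 < e1)%R) (e2_gt0 : (0 < e2)%R) :
  complete_heyting (lifetime e1 e2) /\
  is_topos (sheaf_cat (lifetime e1 e2)) /\
  omega_determined_by_sieves (lifetime e1 e2) /\
  exists omega_sheaf : is_sheaf (omega (lifetime e1 e2)),
    @is_subobject_classifier (sheaf_cat (lifetime e1 e2))
      (Sheaf omega_sheaf).
Proof.
have HP := lifetime_complete_heyting (ltW e1_gt0) (ltW e2_gt0).
split=> //; split; first exact: sheaf_topos.
split; first exact: omega_of_sieves.
by exists (omega_is_sheaf HP); exact: omega_subobject_classifier.
Qed.
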